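(* Let $\alpha: G\curvearrowright X$ be a distal action of an infinite countable discrete group $G$ on the Cantor set $X$ such that the free points of $\alpha$ are dense in $X$. Then the topological full group $[[\alpha]]$ is amenable if and only if $G$ is amenable.
   Context: Actions are continuous (by homeomorphisms), and $X$ carries a compatible metric $d$. The action $\alpha$ is distal if $\inf_{g\in G}d(gx,gy)>0$ whenever $x\neq y$ in $X$. A point $x\in X$ is free if $gx\ne x$ for all $g\in G\setminus\{e_G\}$. The topological full group $[[\alpha]]$ is the group (under composition) of all homeomorphisms $\varphi: X\to X$ for which there is a continuous map $c(\varphi): X\to G$ ($G$ discrete) with $\varphi(x)=\alpha_{c(\varphi)(x)}(x)$ for all $x\in X$. Amenability of $[[\alpha]]$ is as a discrete group. *)

(* Defs.v *)
From HB Require Import structures.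
From mathcomp Require Import all_boot all_order all_algebra.
From mathcomp Require Import all_classical all_reals all_analysis.

Set Implicit Arguments.
Unset Strict Implicit.
Unset Printing Implicit Defensive.

Import Order.TTheory GRing.Theory Num.Theory.
Import numFieldNormedType.Exports.

Local Open Scope classical_set_scope.
Local Open Scope ring_scope.

Definition homeomorphism (X Y : topologicalType) (f : X -> Y) : Prop :=
  continuous f /\ exists g : Y -> X, [/\ continuous g, cancel f g & cancel g f].

Definition cantor_set (X : topologicalType) : Prop :=
  exists f : X -> cantor_space, homeomorphism f.

(* Each [act g] is automatically a homeomorphism, with inverse [act g^-1]. *)
Record action (G : groupType) (X : topologicalType) := Action {
  act :> G -> X -> X;
  act1 : forall x, act 1%g x = x;
  actM : forall g h x, act (g * h)%g x = act g (act h x);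
  act_continuous : forall g, continuous (act g)
}.

Definition distal (R : realType) (G : groupType) (X : metricType R)
    (a : action G X) : Prop :=
  forall x y : X, x != y -> 0 < inf (range (fun g : G => mdist (a g x) (a g y))).

Definition free_point (G : groupType) (X : topologicalType) (a : action G X)
    (x : X) : Prop :=
  forall g : G, g != 1%g -> a g x != x.

Definition in_full_group (G : groupType) (X : topologicalType) (a : action G X)
    (f : X -> X) : Prop :=
  homeomorphism f /\
  exists c : X -> discrete_topology G, continuous c /\ forall x, f x = a (c x) x.

Record full_group (G : groupType) (X : topologicalType) (a : action G X) :=
  FullGroup {
    full_fun :> X -> X;
    full_funP : `[< in_full_group a full_fun >]
  }.

HB.instance Definition _ (G : groupType) (X : topologicalType)
    (a : action G X) := [isSub for @full_fun G X a].
HB.instance Definition _ (G : groupType) (X : topologicalType)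
    (a : action G X) := [Choice of full_group a by <:].

Section full_group_is_group.
Context (G : groupType) (X : topologicalType) (a : action G X).
Implicit Types f g : full_group a.

Lemma discrete_continuousP (c : X -> discrete_topology G) :
  continuous c <-> forall x, \forall y \near x, c y = c x.
Proof.
split=> cc x.
  have : nbhs (c x) [set c x] by rewrite nbhs_principalE; exact/principal_filterP.
  exact: cc.
move=> A; rewrite nbhs_principalE => /principal_filterP Ax.
by apply: (@filterS _ (nbhs x) _ _ _ _ (cc x)) => y /= ->.
Qed.

Lemma full_one_subproof : `[< in_full_group a id >].
Proof.
apply/asboolP; split; last first.
  exists (fun=> 1%g : discrete_topology G).
  by split=> [x|x]; [exact: cvg_cst | rewrite act1].
by split; [|exists id; split]; move=> // x; exact: cvg_id.
Qed.

Lemma full_mul_subproof f g : `[< in_full_group a (f \o g) >].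
Proof.
have /asboolP[[fc [f' [f'c fK f'K]]] [cf [cfc cfE]]] := full_funP f.
have /asboolP[[gc [g' [g'c gK g'K]]] [cg [cgc cgE]]] := full_funP g.
apply/asboolP; split.
  split; first by move=> x; apply: continuous_comp; [exact: gc | exact: fc].
  exists (g' \o f'); split; [|exact: can_comp|exact: can_comp].
  by move=> x; apply: continuous_comp; [exact: f'c | exact: g'c].
exists (fun x => cf (g x) * cg x : discrete_topology G)%g; split; last first.
  by move=> x; rewrite /= actM -cgE -cfE.
apply/discrete_continuousP => x.
have H1 : nbhs x (g @^-1` [set z | cf z = cf (g x)]).
  exact/gc/((discrete_continuousP cf).1 cfc).
have H2 : nbhs x [set y | cg y = cg x] := (discrete_continuousP cg).1 cgc x.
by apply: filterS2 H1 H2 => y /= -> ->.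
Qed.

Lemma full_inv_subproof f :
  {g : X -> X | [/\ `[< in_full_group a g >], cancel f g & cancel g f]}.
Proof.
apply: cid.
have /asboolP[[fc [f' [f'c fK f'K]]] [cf [cfc cfE]]] := full_funP f.
exists f'; split=> //; apply/asboolP; split; first by split=> //; exists f.
exists (fun x => (cf (f' x))^-1 : discrete_topology G)%g; split; last first.
  by move=> x; rewrite -[in RHS](f'K x) fK [in RHS]cfE -actM mulVg act1.
apply/discrete_continuousP => x.
have H : nbhs x (f' @^-1` [set z | cf z = cf (f' x)]).
  exact/f'c/((discrete_continuousP cf).1 cfc).
by apply: filterS H => y /= ->.
Qed.

Definition full_one : full_group a := FullGroup full_one_subproof.
Definition full_mul f g : full_group a := FullGroup (full_mul_subproof f g).
Definition full_inv f : full_group a :=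
  let: exist g P := full_inv_subproof f in
  let: And3 Pg _ _ := P in FullGroup Pg.

Lemma full_mulA : associative full_mul.
Proof. by move=> f g h; exact/val_inj. Qed.

Lemma full_mul1 : left_id full_one full_mul.
Proof. by move=> f; exact/val_inj. Qed.

Lemma full_mulr1 : right_id full_one full_mul.
Proof. by move=> f; exact/val_inj. Qed.

Lemma full_mulV : left_inverse full_one full_inv full_mul.
Proof.
move=> f; apply/val_inj; rewrite /full_inv.
case: (full_inv_subproof f) => g [Pg fK gK] /=.
by apply/funext => x /=; exact: fK.
Qed.

Lemma full_mulrV : right_inverse full_one full_inv full_mul.
Proof.
move=> f; apply/val_inj; rewrite /full_inv.
case: (full_inv_subproof f) => g [Pg fK gK] /=.
by apply/funext => x /=; exact: gK.
Qed.

End full_group_is_group.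

HB.instance Definition _ (G : groupType) (X : topologicalType)
    (a : action G X) :=
  isGroup.Build (full_group a) (@full_mulA G X a) (@full_mul1 G X a)
    (@full_mulr1 G X a) (@full_mulV G X a) (@full_mulrV G X a).

(* Existence of a left-invariant mean on the bounded real functions on G.
   Values of m outside the bounded functions are unconstrained. *)
Definition amenable (R : realType) (G : groupType) : Prop :=
  exists m : (G -> R) -> R,
    [/\ forall (k : R) (u v : G -> R), bounded_fun u -> bounded_fun v ->
          m (fun x => k * u x + v x) = k * m u + m v,
        forall u : G -> R, bounded_fun u -> (forall x, 0 <= u x) -> 0 <= m u,
        m (fun=> 1) = 1 &
        forall (g : G) (u : G -> R), bounded_fun u ->
          m (fun x => u (g * x)%g) = m u].

(* Main.v *)
Require Import Defs.
From HB Require Import structures.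
From mathcomp Require Import all_boot all_order all_algebra.
From mathcomp Require Import perm.
From mathcomp Require Import all_classical all_reals all_analysis.

(** Write K for the topological full group. Since free points are dense, every
    f in K has exactly one continuous cocycle c_f : X -> G with
    f x = c_f(x) x ([cocycle_unique]), and uniqueness makes it multiplicative:
    c_(fh)(x) = c_f(h x) c_h(x) ([cocycle_mul]).

    If K is amenable, fix a free point x0. The map f |-> c_f(x0) from K to G
    intertwines left multiplication by g, viewed as an element of K, with left
    multiplication by g, so an invariant mean on K pushes forward to one on G
    ([amenable_of_full_group]).

    For the converse, an ultrafilter limit reduces the problem to finding, for
    every finite subset F of K, a mean on K that is invariant under F
    ([amenable_local]). By compactness the cocycles of the elements of F and
    of their inverses take finitely many values; let S be the finite symmetric
    set of these values together with 1, and let kappa(x) list the values of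
    these cocycles at x.

    The dynamical input is that a distal action of a finitely generated group
    cannot spread the locally constant map kappa over infinitely many
    translates: for some N, if kappa(hx) = kappa(hy) for all words h in S of
    length at most N, then this holds for all words ([distal_stabilization]).
    Suppose not. Looking at the first length at which some pair (x, y) gets
    separated, and passing to a cluster point of the separated pairs, one finds
    z = (z1, z2) with kappa(z1) <> kappa(z2) and elements g_r of the group H
    generated by S such that every word of length r fails to separate g_r z.
    A cluster point p of the g_r in the closure of H in X^X then has
    kappa(h p z1) = kappa(h p z2) for all h in H. Distality makes the elements
    of this closure injective, so its only idempotent is the identity, and the
    Ellis-Numakura lemma gives q in the closure with q p = id
    ([enveloping_left_inverse]). Approximating q by h in H on p z1 and p z2
    yields kappa(z1) = kappa(z2), a contradiction.

    Consequently X is partitioned into finitely many blocks, indexed by a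
    finite type P, that the elements of F permute and on which their cocycles
    are constant. Elements of this kind embed into the wreath product of G by
    Sym(P), whose amenability follows from that of G: they act freely on
    G^P x Sym(P) by (k, t) |-> ((c_f(t i) k_i)_i, fbar o t), and the product of
    card P copies of the mean of G, averaged over Sym(P), is an invariant mean
    there. An equivariant map from G^P x Sym(P) to K transports it to K
    ([amenable_block_mean]). *)

Set Implicit Arguments.
Unset Strict Implicit.
Unset Printing Implicit Defensive.

Import Order.TTheory GRing.Theory Num.Theory.
Import numFieldNormedType.Exports.

Local Open Scope classical_set_scope.
Local Open Scope ring_scope.

(** * Idempotents in compact right topological semigroups *)

Lemma compact_chain_meets (T : topologicalType) (K : set T)
    (F : set (set T)) :
  compact K -> K !=set0 ->
  (forall B, F B -> [/\ B `<=` K, closed B & B !=set0]) ->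
  total_on F subset ->
  K `&` \bigcap_(B in F) B !=set0.
Proof.
move=> cK K0 FP totF.
pose D := F `|` [set K].
have DP B : D B -> B `<=` K /\ B !=set0.
  by move=> [/FP[? _ ?] | ->]; split.
have FF : Filter (filter_from D id).
  apply: filter_from_filter; first by exists K; right.
  move=> A B [FA|->] [FB|->].
  - have [AB|BA] := totF _ _ FA FB.
      by exists A; [left|move=> x Ax; split; auto].
    by exists B; [left|move=> x Bx; split; auto].
  - by exists A; [left|move=> x Ax; split=> //; have [+ _ _] := FP _ FA; apply].
  - by exists B; [left|move=> x Bx; split=> //; have [+ _ _] := FP _ FB; apply].
  - by exists K; [right|move=> x Kx; split].
have PF : ProperFilter (filter_from D id).
  by apply: filter_from_proper => B /DP[].
have [|x [Kx xcl]] := cK _ PF; first by exists K; [right|].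
exists x; split=> // B FB; have [_ clB _] := FP _ FB.
rewrite closure_id in clB; rewrite clB => U xU.
by apply: xcl => //; exists B; [left|].
Qed.

(** By Zorn's lemma and compactness there is a minimal nonempty closed
    subsemigroup B. For t in B both B t and the stabilizer of t in B are closed
    subsemigroups of B, so minimality forces first B t = B, which makes the
    stabilizer nonempty, and then that t itself stabilizes t. Composition
    of arbitrary self-maps in the pointwise topology has continuous right
    translations, but in general not continuous left ones. *)
Lemma ellis_numakura (T : topologicalType) (op : T -> T -> T) (K : set T) :
  hausdorff_space T -> associative op -> (forall t, continuous (op^~ t)) ->
  compact K -> K !=set0 -> (forall s t, K s -> K t -> K (op s t)) ->
  exists2 e, K e & op e e = e.
Proof.
move=> hT opA opC cK K0 opK.
pose Q (B : set T) := [/\ B `<=` K, closed B, B !=set0 &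
  forall s t, B s -> B t -> B (op s t)].
(* Zorn's lemma yields maximal elements, hence the complements in K. *)
pose P (A : set T) := A `<=` K /\ Q (K `\` A).
have clK := compact_closed hT cK.
have [F FP totF|A [[AK [_ clB B0 opB]] maxA]] := @Zorn_bigcup T P.
  pose F' := [set K `\` A | A in F].
  have F'P B : F' B -> Q B by move=> [A /FP[_ QA] <-].
  have totF' : total_on F' subset.
    move=> _ _ [A FA <-] [B FB <-].
    by have [AB|BA] := totF _ _ FA FB; [right|left]; exact: setDS.
  have E : K `\` \bigcup_(A in F) A = K `&` \bigcap_(B in F') B.
    apply/seteqP; split=> [x [Kx nx]|x [Kx Bx]]; split=> //.
      by move=> _ [A FA <-]; split=> // Ax; apply: nx; exists A.
    by move=> [A FA Ax]; have [] := Bx (K `\` A) (imageP _ FA).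
  split; first by move=> x [A /FP[AK _] /AK].
  rewrite E; split; first exact: subIsetl.
  - by apply: closedI => //; apply: closed_bigI => B /F'P[].
  - by apply: compact_chain_meets => // B /F'P[].
  - move=> s t [Ks Fs] [Kt Ft]; split; first exact: opK.
    by move=> B FB; have [_ _ _] := F'P _ FB; apply; [exact: Fs|exact: Ft].
have minB B : Q B -> B `<=` K `\` A -> K `\` A `<=` B.
  move=> QB BKA x [Kx nAx]; apply: contrapT => nBx.
  apply: (maxA (K `\` B)); last first.
    split; first exact: subDsetl.
    by rewrite setDD setIC (_ : B `&` K = B) //; apply/setIidPl; case: QB.
  split; last by move=> /(_ x (conj Kx nBx)).
  by move=> y Ay; split; [exact: AK|move=> /BKA[]].
have cB : compact (K `\` A) by exact: (subclosed_compact _ cK).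
move: minB => {maxA AK}; set B := K `\` A => minB.
have [t Bt] := B0.
have Bt1 : B `<=` op^~ t @` B.
  apply: minB; last by move=> _ [s Bs <-]; exact: opB.
  split.
  - by move=> _ [s [Ks _] <-]; apply: opK => //; case: Bt.
  - apply: compact_closed => //; apply: continuous_compact => //.
    by apply: continuous_subspaceT; exact: opC.
  - by exists (op t t), t.
  - move=> _ _ [s Bs <-] [s' Bs' <-]; exists (op (op s t) s'); rewrite ?opA//.
    exact: opB (opB _ _ Bs Bt) Bs'.
have Bt2 : B `<=` B `&` op^~ t @^-1` [set t].
  apply: minB; last exact: subIsetl.
  split.
  - by move=> s [[]].
  - apply: closedI => //; apply: preimage_closed => [s _|]; first exact: opC.
    exact/accessible_closed_set1/hausdorff_accessible.
  - by have [s Bs st] := Bt1 _ Bt; exists s.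
  - move=> r s [Br rt] [Bs st]; split; first exact: opB.
    by rewrite /preimage /= -opA st rt.
by exists t; [case: Bt | have [_] := Bt2 _ Bt].
Qed.

(** * The enveloping semigroup of a distal action *)

Lemma closure_minimal (T : topologicalType) (A C : set T) :
  closed C -> A `<=` C -> closure A `<=` C.
Proof.
by move=> clC AC; rewrite (closure_id C).1 //; exact: closure_subset.
Qed.

Section Pointwise.
Variable X : topologicalType.
Local Notation XX := {ptws X -> X}.

Lemma ptws_eval (x : X) : continuous (fun f : XX => f x).
Proof. exact: (@proj_continuous X (fun _ => X) x). Qed.

Lemma ptws_continuous (T : topologicalType) (F : T -> XX) :
  (forall x, continuous (fun t => F t x)) -> continuous F.
Proof.
move=> cF t; apply/cvg_sup => x; apply/cvg_image.
  by apply/seteqP; split=> // y _; exists (fun=> y).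
move=> U xU; exists ((fun f : XX => f x) @^-1` U).
  exact: cF.
by apply/seteqP; split=> [_ [f Uf <-] //|y Uy]; exists (fun=> y).
Qed.

Lemma comp_right_continuous (q : X -> X) :
  continuous (fun p : XX => (p \o q : XX)).
Proof. by apply: ptws_continuous => x; exact: ptws_eval. Qed.

Lemma comp_left_continuous (f : X -> X) : continuous f ->
  continuous (fun p : XX => (f \o p : XX)).
Proof.
move=> cf; apply: ptws_continuous => x p.
by apply: (@continuous_comp _ _ _ (fun p : XX => p x) f);
  [exact: ptws_eval|exact: cf].
Qed.

Lemma ptws_compact : compact [set: X] -> compact [set: XX].
Proof.
move=> cX; have := @tychonoff X (fun _ => X) (fun _ => setT) (fun _ => cX).
by congr compact; apply/seteqP.
Qed.

Lemma ptws_hausdorff : hausdorff_space X -> hausdorff_space XX.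
Proof. by move=> hX; exact: hausdorff_product. Qed.

End Pointwise.

Section Enveloping.
Context (R : realType) (G : groupType) (X : metricType R) (a : action G X).
Variable H : set G.
Hypothesis cX : compact [set: X].
Hypothesis da : distal a.
Hypothesis HM : forall g h, H g -> H h -> H (g * h)%g.

(** The closure is that of H and not of all of G, so that the values of its
    elements at finitely many points can be approximated by elements of H. *)
Definition enveloping_semigroup : set {ptws X -> X} :=
  closure [set (a h : {ptws X -> X}) | h in H].

Local Notation E := enveloping_semigroup.

Lemma enveloping_compact : compact E.
Proof.
by apply: (subclosed_compact _ (ptws_compact cX)) => //; exact: closed_closure.
Qed.

(** Left translation by p need not be continuous when p is a mere limit, so the
    closure is taken in two stages: first in the right factor, with the left
    one in H, then in the left factor. *)
Lemma enveloping_comp p q : E p -> E q -> E (p \o q).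
Proof.
move=> Ep Eq.
pose rq (f : {ptws X -> X}) : {ptws X -> X} := f \o q.
suff /(_ p Ep) : E `<=` rq @^-1` E by [].
apply: closure_minimal.
  apply: preimage_closed => [? _|]; last exact: closed_closure.
  exact: comp_right_continuous.
move=> _ [h Hh <-].
pose lh (f : {ptws X -> X}) : {ptws X -> X} := a h \o f.
suff /(_ q Eq) : E `<=` lh @^-1` E by [].
apply: closure_minimal.
  apply: preimage_closed => [? _|]; last exact: closed_closure.
  exact/comp_left_continuous/act_continuous.
move=> _ [k Hk <-]; apply: subset_closure; exists (h * k)%g; first exact: HM.
by apply/funext => x; rewrite actM.
Qed.

(** The lower bound on the distances d(hx, hy) passes to pointwise limits. *)
Lemma enveloping_inj p : E p -> injective p.
Proof.
move=> Ep x y pxy; apply: contrapT => /eqP xy.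
have [d d0 dP] : exists2 d : R, 0 < d & forall g, d <= mdist (a g x) (a g y).
  exists (inf (range (fun g : G => mdist (a g x) (a g y)))); first exact: da.
  move=> g; apply: ge_inf; last by exists g.
  by exists 0 => _ [? _ <-]; exact: mdist_ge0.
have d20 : 0 < d / 2 by rewrite divr_gt0.
have nx z : nbhs p [set f : {ptws X -> X} | ball (p z) (d / 2) (f z)].
  exact/(@ptws_eval X z)/nbhsx_ballx.
have [f [[h Hh <-]]] := Ep _ (filterI (nx x) (nx y)).
rewrite /= -pxy => -[/ball_sym b1 b2].
have := ball_triangle b1 b2; rewrite -splitr ballEmdist /= => /lt_le_trans.
by move=> /(_ _ (dP h)); rewrite ltxx.
Qed.

(** The left ideal generated by p contains an idempotent q p, and an injective
    idempotent is the identity. *)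
Lemma enveloping_left_inverse p : E p -> exists2 q, E q & cancel p q.
Proof.
move=> Ep.
pose Ep' := (fun f : {ptws X -> X} => (f \o p : {ptws X -> X})) @` E.
have cEp : compact Ep'.
  apply: continuous_compact enveloping_compact.
  exact/continuous_subspaceT/comp_right_continuous.
have [||_ [q Eq <-] qp] := @ellis_numakura {ptws X -> X}
  (fun f g => f \o g) Ep' (ptws_hausdorff (@metric_hausdorff _ X))
  (fun _ _ _ => erefl) (@comp_right_continuous X) cEp.
- by exists (p \o p), p.
- move=> _ _ [f Ef <-] [g Eg <-]; exists (f \o p \o g) => //.
  exact: (enveloping_comp (enveloping_comp Ef Ep)).
exists q => // x; apply: (enveloping_inj (enveloping_comp Eq Ep)).
by have := congr1 (@^~ x) qp.
Qed.

End Enveloping.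

(** * Distal actions stabilize locally constant maps *)

Definition locally_constant (X : topologicalType) (T : Type) (k : X -> T) :=
  forall x, \forall y \near x, k y = k x.

Section Words.
Context (G : groupType) (S : seq G).
Hypothesis S1 : 1%g \in S.
Hypothesis SV : forall s, s \in S -> (s^-1)%g \in S.

Fixpoint words (n : nat) : seq G :=
  if n is n'.+1 then [seq (s * h)%g | s <- S, h <- words n'] else [:: 1%g].

Lemma words1 s : s \in S -> s \in words 1.
Proof.
by move=> sS; apply/allpairsP; exists (s, 1%g); rewrite mulg1 mem_seq1.
Qed.

Lemma words_mul m n g h :
  g \in words m -> h \in words n -> (g * h)%g \in words (m + n).
Proof.
elim: m g => [|m IH] g; first by rewrite mem_seq1 => /eqP->; rewrite mul1g.
move=> /allpairsP[[s g'] /= [sS g'm ->]] hn; rewrite -mulgA.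
by apply/allpairsP; exists (s, (g' * h)%g); split=> //; exact: IH.
Qed.

Lemma words_split m n g : g \in words (m + n) ->
  exists b t, [/\ b \in words m, t \in words n & g = (b * t)%g].
Proof.
elim: m g => [|m IH] g.
  by move=> gn; exists 1%g, g; rewrite mem_seq1 mul1g.
move=> /allpairsP[[s g'] /= [sS /IH[b [t [bm tn ->]]] ->]].
exists (s * b)%g, t; split=> //; last by rewrite mulgA.
by apply/allpairsP; exists (s, b).
Qed.

Lemma words_one n : 1%g \in words n.
Proof.
elim: n => [|n IH]; first by rewrite mem_seq1.
by apply/allpairsP; exists (1%g, 1%g); rewrite mulg1.
Qed.

Lemma words_mono m n : (m <= n)%N -> {subset words m <= words n}.
Proof.
by move=> mn g gm; rewrite -(subnKC mn) -(mulg1 g) words_mul ?words_one.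
Qed.

Lemma words_inv n g : g \in words n -> (g^-1)%g \in words n.
Proof.
elim: n g => [|n IH] g; first by rewrite !mem_seq1 => /eqP->; rewrite invg1.
move=> /allpairsP[[s g'] /= [sS /IH g'n ->]].
by have := words_mul g'n (words1 (SV sS)); rewrite addn1 invgM.
Qed.

End Words.

Section Stabilization.
Context (R : realType) (G : groupType) (X : metricType R) (a : action G X).
Hypothesis cX : compact [set: X].
Hypothesis da : distal a.
Context (T : Type) (kappa : X -> T).
Hypothesis kc : locally_constant kappa.
Context (S : seq G).
Hypothesis S1 : 1%g \in S.
Hypothesis SV : forall s, s \in S -> (s^-1)%g \in S.

Lemma locally_constant_translates (s : seq G) x :
  \forall y \near x, forall h, h \in s -> kappa (a h y) = kappa (a h x).
Proof.
elim: s => [|g s IH]; first by near=> y.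
have gx : \forall y \near x, kappa (a g y) = kappa (a g x).
  exact: (@act_continuous _ _ a g x _ (kc (a g x))).
apply: filterS2 gx IH => y gy sy h; rewrite inE => /orP[/eqP->//|]; exact: sy.
Unshelve. all: by end_near. Qed.

(** The translate of z by g lies deep inside the region where kappa agrees on
    both coordinates. Bounding the lengths of g and k leaves finitely many
    group elements, so that the condition survives passing to a cluster point
    of the pairs z. *)
Definition late_separation r (z : X * X) := exists2 g, g \in words S r.+1 &
  forall k, k \in words S r -> kappa (a k (a g z.1)) = kappa (a k (a g z.2)).

(** Let h be a shortest word separating x and y, and z = (hx, hy). Undoing the
    r + 1 letters of h applied last leads to a pair that no word of length r
    separates: a separating one would turn the remaining letters of h into a
    word that is shorter than h and separates x and y. *)
Lemma first_separation N x y :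
  (forall h, h \in words S N -> kappa (a h x) = kappa (a h y)) ->
  (exists n h, h \in words S n /\ kappa (a h x) <> kappa (a h y)) ->
  exists z : X * X, kappa z.1 <> kappa z.2 /\
    forall r, (r <= N)%N -> late_separation r z.
Proof.
move=> agN [n0 [h0 [h0n h0P]]].
pose sep n :=
  `[< exists h, h \in words S n /\ kappa (a h x) <> kappa (a h y) >].
have exsep : exists n, sep n by exists n0; apply/asboolP; exists h0.
have [m /asboolP[h [hm hP]] mmin] := ex_minnP exsep.
have Nm : (N < m)%N.
  rewrite ltnNge; apply/negP => mN; apply: hP; apply: agN.
  exact: words_mono hm.
exists (a h x, a h y); split=> //= r rN.
have rm : (r.+1 <= m)%N by exact: leq_ltn_trans Nm.
move: hm; rewrite -(subnKC rm) => /words_split[b [t [br tm hE]]].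
exists (b^-1)%g; first exact: words_inv.
move=> k kr; rewrite /= hE -!actM !mulgA mulgVK; apply: contrapT => kP.
have /mmin : sep (r + (m - r.+1))%N.
  by apply/asboolP; exists (k * t)%g; split=> //; exact: words_mul.
by rewrite leqNgt => /negP; apply; rewrite -[X in (_ < X)%N](subnKC rm) addSn.
Qed.

(** A cluster point p of the elements g_r moves z into the set of pairs that no
    element of H separates. As p has a left inverse q in the closure of H, z is
    a limit of translates of p z and is not separated either. *)
Lemma no_late_separation z : kappa z.1 <> kappa z.2 ->
  (forall r, late_separation r z) -> False.
Proof.
move=> kz late; have /choice[g gP] : forall r, exists g, g \in words S r.+1 /\
    forall k, k \in words S r -> kappa (a k (a g z.1)) = kappa (a k (a g z.2)).
  by move=> r; have [g gr gP] := late r; exists g.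
pose H : set G := [set h | exists n, h \in words S n].
have HM h k : H h -> H k -> H (h * k)%g.
  by move=> [m hm] [n kn]; exists (m + n)%N; exact: words_mul.
have Hg r : H (g r) by have [gr _] := gP r; exists r.+1.
pose gg r : {ptws X -> X} := a (g r).
have [|p [Ep pcl]] := @enveloping_compact R G X a H cX (gg @ \oo) _.
  by exists 0%N => // r _; apply: subset_closure; exists (g r).
have [q Eq pq] := enveloping_left_inverse cX da HM Ep.
have nq w : nbhs q [set f : {ptws X -> X} | kappa (f w) = kappa (q w)].
  exact: (@ptws_eval X w q _ (kc (q w))).
have [_ [[h [n hn] <-] [/= h1 h2]]] := Eq _ (filterI (nq (p z.1)) (nq (p z.2))).
rewrite !pq in h1 h2.
have np w : nbhs p
    [set f : {ptws X -> X} | kappa (a h (f w)) = kappa (a h (p w))].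
  apply: (@ptws_eval X w p [set y | kappa (a h y) = kappa (a h (p w))]).
  exact: (@act_continuous _ _ a h (p w) _ (kc (a h (p w)))).
have tail : (gg @ \oo) [set f | exists2 r, (n <= r)%N & f = gg r].
  by exists n => // r nr; exists r.
have [_ [[r nr ->] [/= e1 e2]]] := pcl _ _ tail (filterI (np z.1) (np z.2)).
apply: kz; rewrite -h1 -h2 -e1 -e2; have [_] := gP r; apply.
exact: words_mono hn.
Unshelve. all: by end_near. Qed.

(** Otherwise every N provides a pair that is separated, but only by words
    longer than N; a cluster point of the resulting pairs contradicts
    [no_late_separation]. *)
Lemma distal_stabilization : exists N, forall x y,
  (forall h, h \in words S N -> kappa (a h x) = kappa (a h y)) ->
  forall n h, h \in words S n -> kappa (a h x) = kappa (a h y).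
Proof.
apply: contrapT => /forallNP nst.
have /choice[z zP] : forall N, exists z : X * X, kappa z.1 <> kappa z.2 /\
    forall r, (r <= N)%N -> late_separation r z.
  move=> N; have /existsNP[x /existsNP[y /not_implyP[agN]]] := nst N.
  move=> /existsNP[n /existsNP[h /not_implyP[hn hP]]].
  by apply: (first_separation agN); exists n, h.
have cXX : compact [set: X * X] by rewrite -setXTT; exact: compact_setX.
have [|[z1 z2] [_ zcl]] := cXX (z @ \oo) _; first exact: filterT.
have nz r : exists2 N, (r <= N)%N & forall h, h \in words S (r + r.+1) ->
    kappa (a h (z N).1) = kappa (a h z1) /\
    kappa (a h (z N).2) = kappa (a h z2).
  have late : (z @ \oo) [set f | exists2 N, (r <= N)%N & f = z N].
    by exists r => // N rN; exists N.
  pose nbh w := [set y |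
    forall h, h \in words S (r + r.+1) -> kappa (a h y) = kappa (a h w)].
  have nn : nbhs (z1, z2) (nbh z1 `*` nbh z2).
    by exists (nbh z1, nbh z2) => //; split; exact: locally_constant_translates.
  have [_ [[N rN ->] [/= n1 n2]]] := zcl _ _ late nn.
  by exists N => // h hr; split; [exact: n1|exact: n2].
apply: (@no_late_separation (z1, z2)) => [|r].
  have [N _ /(_ _ (words_one S1 _))] := nz 0%N; rewrite !act1 /= => -[<- <-].
  by case: (zP N).
have [N rN NP] := nz r; have [_ /(_ _ rN)[g gr gP]] := zP N.
exists g => // k kr /=; rewrite -!actM.
have [<- <-] := NP _ (words_mul kr gr); rewrite !actM; exact: gP.
Unshelve. all: by end_near. Qed.

End Stabilization.

(** * Means and amenability *)

(** The filter of tails of the directed set of finite subsets of T, a list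
    standing for the set of its entries. *)
Definition seq_above (T : eqType) : set_system (seq T) :=
  filter_from setT (fun s : seq T => [set t : seq T | {subset s <= t}]).

Instance seq_above_proper (T : eqType) : ProperFilter (@seq_above T).
Proof.
apply: filter_from_proper; last by move=> s _; exists s.
apply: filter_from_filter; first by exists [::].
by move=> s t _ _; exists (s ++ t) => // w stw; split=> x xs; apply: stw;
  rewrite mem_cat xs ?orbT.
Qed.

Section Means.
Context (R : realType).

Lemma bounded_fun_exP (Y : Type) (u : Y -> R) :
  bounded_fun u <-> exists B, forall y, `|u y| <= B.
Proof.
split=> [[M [_ /(_ (M + 1)) MB]]|[B uB]].
  by exists (M + 1) => y; apply: MB => //; rewrite ltrDl.
exists B; split=> [|M BM y _]; first exact: num_real.
exact: le_trans (uB y) (ltW BM).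
Qed.

Lemma bounded_fun_comp (Y Z : Type) (u : Z -> R) (r : Y -> Z) :
  bounded_fun u -> bounded_fun (fun y => u (r y)).
Proof. by move=> /bounded_fun_exP[B uB]; apply/bounded_fun_exP; exists B. Qed.

Lemma bounded_fun_lin (Y : Type) (k : R) (u v : Y -> R) :
  bounded_fun u -> bounded_fun v -> bounded_fun (fun y => k * u y + v y).
Proof.
move=> /bounded_fun_exP[B uB] /bounded_fun_exP[C vC]; apply/bounded_fun_exP.
exists (`|k| * B + C) => y; rewrite (le_trans (ler_normD _ _)) // lerD //.
by rewrite normrM ler_wpM2l.
Qed.

Definition is_mean (Y : Type) (m : (Y -> R) -> R) : Prop :=
  [/\ forall (k : R) (u v : Y -> R), bounded_fun u -> bounded_fun v ->
        m (fun y => k * u y + v y) = k * m u + m v,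
      forall u : Y -> R, bounded_fun u -> (forall y, 0 <= u y) -> 0 <= m u &
      m (fun=> 1) = 1].

Definition invariant_mean (Y : Type) (m : (Y -> R) -> R) (f : Y -> Y) : Prop :=
  forall u : Y -> R, bounded_fun u -> m (fun y => u (f y)) = m u.

Lemma amenableP (G : groupType) : amenable R G <->
  exists m : (G -> R) -> R, is_mean m /\
    forall g, invariant_mean m (fun x => (g * x)%g).
Proof.
by split=> [[m [ml mp m1 mi]]|[m [[ml mp m1] mi]]]; exists m; split.
Qed.

Lemma mean_cst (Y : Type) (m : (Y -> R) -> R) (c : R) :
  is_mean m -> m (fun=> c) = c.
Proof.
move=> [ml _ m1].
have b (d : R) : bounded_fun (fun _ : Y => d).
  by apply/bounded_fun_exP; exists `|d|.
have m0 : m (fun=> 0) = 0.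
  have := ml (-1) (fun=> 0) (fun=> 0) (b 0) (b 0).
  under eq_fun do rewrite mulr0 addr0.
  by rewrite mulN1r addNr.
have := ml c (fun=> 1) (fun=> 0) (b 1) (b 0).
under eq_fun do rewrite mulr1 addr0.
by rewrite m1 m0 mulr1 addr0.
Qed.

Lemma mean_bound (Y : Type) (m : (Y -> R) -> R) (u : Y -> R) (B : R) :
  is_mean m -> (forall y, `|u y| <= B) -> `|m u| <= B.
Proof.
move=> mm uB; have [ml mp _] := mm.
have bu : bounded_fun u by apply/bounded_fun_exP; exists B.
have bB : bounded_fun (fun _ : Y => B) by apply/bounded_fun_exP; exists `|B|.
rewrite ler_norml; apply/andP; split.
  have : 0 <= m (fun y => 1 * u y + B).
    apply: mp => [|y]; first exact: bounded_fun_lin.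
    have := uB y; rewrite ler_norml mul1r => /andP[+ _].
    by rewrite -lerBlDr sub0r.
  by rewrite ml // mean_cst // mul1r -lerBlDr sub0r.
have : 0 <= m (fun y => -1 * u y + B).
  apply: mp => [|y]; first exact: bounded_fun_lin.
  have := uB y; rewrite ler_norml mulN1r => /andP[_ +].
  by rewrite addrC subr_ge0.
by rewrite ml // mean_cst // mulN1r addrC subr_ge0.
Qed.

Lemma mean_map (Y Z : Type) (m : (Y -> R) -> R) (r : Y -> Z) :
  is_mean m -> is_mean (fun u : Z -> R => m (fun y => u (r y))).
Proof.
move=> [ml mp m1]; split=> // [k u v bu bv|u bu u0].
  by rewrite -ml //; exact: bounded_fun_comp.
by apply: mp => //; exact: bounded_fun_comp.
Qed.

Lemma mean_average (Y : Type) (I : finType) (m : I -> (Y -> R) -> R) :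
  (0 < #|I|)%N -> (forall i, is_mean (m i)) ->
  is_mean (fun u => (\sum_i m i u) / #|I|%:R).
Proof.
move=> I0 mm; split=> [k u v bu bv|u bu u0|].
- rewrite mulrA -mulrDl mulr_sumr -big_split /=; congr (_ / _).
  by apply: eq_bigr => i _; have [ml _ _] := mm i; rewrite ml.
- rewrite divr_ge0 // sumr_ge0 // => i _.
  by have [_ mp _] := mm i; exact: mp.
- rewrite (eq_bigr (fun=> 1)) => [|i _]; last by have [_ _] := mm i.
  by rewrite sumr_const divff // pnatr_eq0 -lt0n.
Qed.

Lemma ultrafilter_cvg (I : Type) (U : set_system I) (f : I -> R) (B : R) :
  UltraFilter U -> (forall i, `|f i| <= B) -> cvg (f @ U).
Proof.
move=> UU fB.
have [|l [_ cl]] := @segment_compact R (- B) B (f @ U) _.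
  apply: (@filterS _ U _ setT) => [i _|]; last exact: filterT.
  by rewrite /= in_itv /= -ler_norml.
apply/cvg_ex; exists l => A lA.
have [//|nA] := in_ultra_setVsetC (f @^-1` A) UU.
have nA' : (f @ U) (~` A) by [].
by have [y [nAy Ay]] := cl _ _ nA' lA.
Qed.

Lemma mean_ultralimit (I Y : Type) (U : set_system I) (m : I -> (Y -> R) -> R) :
  UltraFilter U -> (forall i, is_mean (m i)) ->
  is_mean (fun u => lim (m i u @[i --> U])).
Proof.
move=> UU mm.
have cv (u : Y -> R) : bounded_fun u -> cvg (m i u @[i --> U]).
  move=> /bounded_fun_exP[B uB].
  by apply: (@ultrafilter_cvg _ _ _ B) => i; exact: mean_bound.
split=> [k u v bu bv|u bu u0|].
- apply/cvg_lim => //.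
  rewrite (_ : (fun i => _) = (fun i => k * m i u + m i v)).
    by apply: cvgD; [apply: cvgM; [exact: cvg_cst|exact: cv]|exact: cv].
  by apply/funext => i; have [ml _ _] := mm i; rewrite ml.
- apply: limr_ge; first exact: cv.
  by apply: nearW => i; have [_ mp _] := mm i; exact: mp.
- apply/cvg_lim => //.
  rewrite (_ : (fun i => _) = (fun=> 1)); first exact: cvg_cst.
  by apply/funext => i; have [_ _] := mm i.
Qed.

(** A limit of the means m_F along an ultrafilter finer than the filter of
    finite sets is invariant under each g, because g belongs to eventually
    all F. *)
Lemma amenable_local (G : groupType) :
  (forall F : seq G, exists m : (G -> R) -> R, is_mean m /\
    forall g, g \in F -> invariant_mean m (fun x => (g * x)%g)) ->
  amenable R G.
Proof.
move=> /choice[m mP].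
have [U [UU PU]] := ultraFilterLemma (seq_above_proper G).
apply/amenableP; exists (fun u => lim (m s u @[s --> U])); split.
  by apply: mean_ultralimit => s; case: (mP s).
move=> g u bu; have ge : \forall s \near U, m s (fun x => u (g * x)%g) = m s u.
  apply: PU; exists [:: g] => // s gs; have [_] := mP s; apply=> //.
  exact/gs/mem_head.
congr (lim _); apply/seteqP; split; apply: near_eq_cvg => //.
by apply: filterS ge => s ->.
Qed.

End Means.

(** * Means on powers of an amenable group *)

Section ProductMean.
Context (R : realType) (G : groupType) (P : finType).
Variable m : (G -> R) -> R.
Hypothesis mm : is_mean m.

Definition update (k : P -> G) (i : P) (g : G) : P -> G :=
  fun j => if j == i then g else k j.

Definition translate (t k : P -> G) : P -> G := fun j => (t j * k j)%g.

(** The coordinates listed in s are integrated out one at a time, while the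
    remaining ones keep their value in k. *)
Fixpoint iterated_mean (s : seq P) (k : P -> G) (u : (P -> G) -> R) : R :=
  if s is i :: s' then m (fun g => iterated_mean s' (update k i g) u) else u k.

Lemma iterated_mean_is_mean s k : is_mean (iterated_mean s k).
Proof.
elim: s k => [|i s IH] k /=; first by split.
have bd u : bounded_fun u ->
    bounded_fun (fun g => iterated_mean s (update k i g) u).
  move=> /bounded_fun_exP[B uB]; apply/bounded_fun_exP; exists B => ?.
  exact: mean_bound.
have [ml mp m1] := mm; split=> [c u v bu bv|u bu u0|].
- rewrite -ml; [|exact: bd|exact: bd].
  congr m; apply/funext => g; have [ml' _ _] := IH (update k i g).
  by rewrite ml'.
- apply: mp => [|g]; first exact: bd.
  by have [_ mp' _] := IH (update k i g); exact: mp'.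
- rewrite -[RHS]m1; congr m; apply/funext => g.
  by have [_ _] := IH (update k i g).
Qed.

Lemma iterated_mean_base s k k' u : (forall j, j \notin s -> k j = k' j) ->
  iterated_mean s k u = iterated_mean s k' u.
Proof.
elim: s k k' => [|i s IH] k k' kk' /=.
  by congr u; apply/funext => j; exact: kk'.
congr m; apply/funext => g; apply: IH => j js; rewrite /update.
by case: eqP => // /eqP ji; apply: kk'; rewrite inE negb_or ji.
Qed.

Hypothesis mG : forall g, invariant_mean m (fun x => (g * x)%g).

(** Tracking the base point k makes the induction work: translating the
    variable coordinates is absorbed by the invariance of m, and only the
    translation of k remains. It disappears when s lists all coordinates. *)
Lemma iterated_mean_translate s t k u : bounded_fun u ->
  iterated_mean s k (fun k' => u (translate t k')) =
  iterated_mean s (translate t k) u.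
Proof.
move=> bu; elim: s k => [//|i s IH] k /=.
rewrite -[RHS](mG (t i)); last first.
  have [B uB] := (bounded_fun_exP u).1 bu; apply/bounded_fun_exP; exists B => g.
  exact: mean_bound (iterated_mean_is_mean _ _) _.
congr m; apply/funext => g; rewrite IH; congr iterated_mean; apply/funext => j.
by rewrite /translate /update; case: eqP => // ->.
Qed.

Lemma product_mean_exists : exists M : ((P -> G) -> R) -> R,
  is_mean M /\ forall t, invariant_mean M (translate t).
Proof.
exists (iterated_mean (enum P) (fun=> 1%g)); split.
  exact: iterated_mean_is_mean.
move=> t u bu; rewrite iterated_mean_translate //.
apply: iterated_mean_base => j; by rewrite mem_enum.
Qed.

End ProductMean.

(** Choose a point in each D-orbit and send y to the element of D that moves the
    chosen point to y. This element is unique, and therefore equivariant in y,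
    when y has trivial stabilizer; nothing is claimed on other orbits. *)
Lemma equivariant_selection (K : groupType) (D : set K) (Y : choiceType)
    (act : K -> Y -> Y) (y0 : Y) :
  D 1%g -> (forall f, D f -> D (f^-1)%g) ->
  (forall f h, D f -> D h -> D (f * h)%g) ->
  (forall y, act 1%g y = y) ->
  (forall f h y, D f -> D h -> act (f * h)%g y = act f (act h y)) ->
  exists r : Y -> K, forall h y, D h ->
    (forall f, D f -> act f y = y -> f = 1%g) -> r (act h y) = (h * r y)%g.
Proof.
move=> D1 DV DM act1 actM.
have actV f y : D f -> act (f^-1)%g (act f y) = y.
  by move=> Df; rewrite -actM ?mulVg //; exact: DV.
pose orb y := [set z | exists2 f, D f & act f z = y].
pose rep y := xget y0 (orb y).
have repP y : orb y (rep y) by apply: (@xgetPex _ y0); exists y, 1%g.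
have rep_act h y : D h -> rep (act h y) = rep y.
  move=> Dh; congr xget; apply/seteqP; split=> z [f Df fz].
    exists (h^-1 * f)%g; first by apply: DM => //; exact: DV.
    by rewrite actM ?fz ?actV //; exact: DV.
  by exists (h * f)%g; [exact: DM|rewrite actM // fz].
have /choice[r rP] : forall y, exists f, D f /\ act f (rep y) = y.
  by move=> y; have [f] := repP y; exists f.
exists r => h y Dh free.
have [Dr ry] := rP y; have [Drh ryh] := rP (act h y).
rewrite rep_act // in ryh.
suff /(congr1 (fun f => h * f * r y)%g) :
    (h^-1 * r (act h y) * (r y)^-1)%g = 1%g.
  by rewrite !mulgA mulgV mul1g mulgVK mulg1.
have Dhr : D (h^-1 * r (act h y))%g by apply: DM => //; exact: DV.
apply: free; first by apply: (DM) => //; exact: DV.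
have ryV : act (r y)^-1%g y = rep y by rewrite -[X in act _ X]ry actV.
rewrite actM //; last exact: DV.
by rewrite ryV actM ?ryh ?actV //; exact: DV.
Qed.

(** * The cocycle of an element of the full group *)

Section Cocycle.
Context (G : groupType) (X : topologicalType) (a : action G X).
Hypothesis free_dense : dense [set x : X | free_point a x].
Local Notation K := (full_group a).

Lemma full_group_cocycle_exists (f : K) : exists c : X -> G,
  locally_constant c /\ forall x, f x = a (c x) x.
Proof.
have /asboolP[_ [c [cc cE]]] := full_funP f.
by exists c; split=> //; exact: (discrete_continuousP c).1 cc.
Qed.

Definition cocycle (f : K) : X -> G := sval (cid (full_group_cocycle_exists f)).

Lemma cocycle_locally_constant f : locally_constant (cocycle f).
Proof. by rewrite /cocycle; case: cid => c []. Qed.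

Lemma cocycleE (f : K) x : f x = a (cocycle f x) x.
Proof. by rewrite /cocycle; case: cid => c []. Qed.

Lemma free_point_act_inj x g h : free_point a x -> a g x = a h x -> g = h.
Proof.
move=> fx gh; apply/eqP; apply: contraTT isT => gnh.
have : (h^-1 * g)%g != 1%g.
  apply: contra_neq gnh => /(congr1 (fun k => h * k)%g).
  by rewrite mulVKg mulg1.
by move=> /fx; rewrite actM gh -actM mulVg act1 eqxx.
Qed.

(** Both maps are constant near a given x, and agree at the free points of any
    neighbourhood of x. *)
Lemma cocycle_unique (c c' : X -> G) :
  locally_constant c -> locally_constant c' ->
  (forall x, a (c x) x = a (c' x) x) -> c = c'.
Proof.
move=> lc lc' cc'; apply/funext => x.
pose V := [set y | c y = c x /\ c' y = c' x].
have U : nbhs x V.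
  by apply: filterS2 (lc x) (lc' x) => y.
have [|y [/interior_subset[/= yc yc'] fy]] :=
  @free_dense (interior V) _ (@open_interior _ V).
  by exists x; exact: U.
by apply: (free_point_act_inj fy); rewrite -yc -yc' cc'.
Qed.

Lemma full_fun_continuous (f : K) : continuous f.
Proof. by have /asboolP[[]] := full_funP f. Qed.

Lemma cocycle_mul (f h : K) x :
  cocycle (f * h)%g x = (cocycle f (h x) * cocycle h x)%g.
Proof.
suff -> : cocycle (f * h)%g = (fun x => cocycle f (h x) * cocycle h x)%g by [].
apply: cocycle_unique => [||{}x]; first exact: cocycle_locally_constant.
  move=> {}x; have fh : \forall y \near x, cocycle f (h y) = cocycle f (h x).
    exact: (@full_fun_continuous h x _ (cocycle_locally_constant f (h x))).
  by apply: filterS2 fh (cocycle_locally_constant h x) => y -> ->.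
by rewrite -cocycleE actM -cocycleE -cocycleE.
Qed.

Lemma cocycle_one x : cocycle 1%g x = 1%g.
Proof.
suff -> : cocycle 1%g = (fun=> 1%g) by [].
apply: cocycle_unique => [||{}x]; first exact: cocycle_locally_constant.
  by move=> {}x; exact: nearW.
by rewrite -cocycleE act1.
Qed.

Lemma cocycle_eq1 (f : K) : (forall x, cocycle f x = 1%g) -> f = 1%g.
Proof.
by move=> f1; apply/val_inj/funext => x; rewrite /= cocycleE f1 act1.
Qed.

End Cocycle.

Section SubgroupAmenable.
Context (R : realType) (G : groupType) (X : topologicalType) (a : action G X).

Lemma act_in_full_group (g : G) : `[< in_full_group a (a g) >].
Proof.
apply/asboolP; split; last first.
  by exists (fun=> g); split=> // x; exact: cvg_cst.
split; first exact: act_continuous.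
exists (a (g^-1)%g); split; first exact: act_continuous.
  by move=> x; rewrite -actM mulVg act1.
by move=> x; rewrite -actM mulgV act1.
Qed.

Definition act_full (g : G) : full_group a := FullGroup (act_in_full_group g).

(** Evaluating cocycles at x0 is equivariant for left multiplication by G, as
    the stabilizer of x0 is trivial. *)
Lemma amenable_of_full_group x0 : free_point a x0 ->
  amenable R (full_group a) -> amenable R G.
Proof.
move=> fx0 /amenableP[m [mm mi]].
apply/amenableP; exists (fun u => m (fun f => u (cocycle f x0))).
split; first exact: (mean_map (fun f => cocycle f x0) mm).
move=> g u bu; rewrite -[RHS](mi (act_full g)); last exact: bounded_fun_comp.
congr m; apply/funext => f; congr u; apply: (free_point_act_inj fx0).
by rewrite actM -!cocycleE.
Qed.

End SubgroupAmenable.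


(** * Finite partitions into blocks *)

Lemma compact_locally_constant_range (X : topologicalType) (T : eqType)
    (k : X -> T) : compact [set: X] -> locally_constant k ->
  exists s : seq T, forall x, k x \in s.
Proof.
move=> /compact_near_coveringP cX kc.
have /filter_ex[s sP] :
    \forall s \near @seq_above T, [set: X] `<=` (fun x => k x \in s).
  apply: cX => x _.
  exists ([set y | k y = k x], [set s : seq T | {subset [:: k x] <= s}]).
    by split; [exact: kc|exists [:: k x]].
  by move=> [y s] /= [-> ]; apply; exact: mem_head.
by exists s => x; exact: sP.
Qed.

Lemma compact_locally_constant_quotient (X : topologicalType) (T : choiceType)
    (k : X -> T) : compact [set: X] -> locally_constant k ->
  exists (P : finType) (pi : X -> P) (rho : P -> X),
    cancel rho pi /\ forall x y, pi x = pi y <-> k x = k y.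
Proof.
move=> cX kc; have [s sP] := compact_locally_constant_range cX kc.
pose s' := [seq t <- s | `[< exists x, k x = t >]].
have s'P x : k x \in s'.
  by rewrite mem_filter sP andbT; apply/asboolP; exists x.
have /choice[rho rhoP] : forall p : seq_sub s', exists x, k x = val p.
  move=> [t /=]; rewrite mem_filter => /andP[/asboolP[x xt] _].
  by exists x.
exists (seq_sub s'), (fun x => SeqSub (s'P x)), rho; split=> [p|x y].
  by apply/val_inj; rewrite /= rhoP.
by split=> [[]//|xy]; apply/val_inj.
Qed.

(** The blocks are the fibres of pi : X -> P, and rho picks a point in each. *)
Section Blocks.
Context (R : realType) (G : groupType) (X : topologicalType) (a : action G X).
Hypothesis free_dense : dense [set x : X | free_point a x].
Local Notation K := (full_group a).
Context (P : finType) (pi : X -> P) (rho : P -> X).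
Hypothesis rhoK : cancel rho pi.

Definition blockwise (f : K) := forall x,
  cocycle f x = cocycle f (rho (pi x)) /\ pi (f x) = pi (f (rho (pi x))).

(** This is left multiplication in the wreath product of G by the self-maps of
    P: the element f induces the map i |-> pi (f (rho i)) on blocks, and acts on
    block i through the group element c_f(rho i). *)
Definition block_act (f : K) (y : (P -> G) * (P -> P)) : (P -> G) * (P -> P) :=
  (fun i => (cocycle f (rho (y.2 i)) * y.1 i)%g, fun i => pi (f (rho (y.2 i)))).

Lemma blockwise1 : blockwise 1%g.
Proof. by move=> x; rewrite !cocycle_one // rhoK. Qed.

Lemma blockwiseM f h : blockwise f -> blockwise h -> blockwise (f * h)%g.
Proof.
move=> bf bh x; have [c1 p1] := bh x.
rewrite !cocycle_mul // c1 (bf (h x)).1 p1 -(bf _).1; split=> //.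
by rewrite [LHS](bf (h x)).2 p1 [RHS](bf (h _)).2.
Qed.

Lemma block_act1 y : block_act 1%g y = y.
Proof.
case: y => k t; congr pair; apply/funext => i /=.
  by rewrite cocycle_one // mul1g.
by rewrite rhoK.
Qed.

Lemma block_actM f h y : blockwise f ->
  block_act (f * h)%g y = block_act f (block_act h y).
Proof.
move=> bf; congr pair; apply/funext => i /=.
  by rewrite cocycle_mul // mulgA (bf (h _)).1.
by rewrite [LHS](bf (h _)).2.
Qed.

Lemma block_act_free f (k : P -> G) (t : P -> P) : blockwise f ->
  (forall i, exists j, t j = i) -> block_act f (k, t) = (k, t) -> f = 1%g.
Proof.
move=> bf tsurj [/(congr1 (fun u => u _)) kE _].
apply: cocycle_eq1 => x; rewrite (bf x).1; have [j <-] := tsurj (pi x).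
by apply: (mulIg (k j)); rewrite mul1g kE.
Qed.

(** Requiring the property of the inverse as well gives a subgroup, whose
    elements permute the blocks. *)
Definition biblockwise : set K := [set f | blockwise f /\ blockwise (f^-1)%g].

Lemma block_perm_inj f : biblockwise f -> injective (fun i => pi (f (rho i))).
Proof.
move=> [bf bfV]; apply: (can_inj (g := fun i => pi ((f^-1)%g (rho i)))) => i.
have := block_actM f (fun=> 1%g, fun=> i) bfV.
by rewrite mulVg block_act1 => /(congr1 (fun y => y.2 i)) /= <-.
Qed.

(** The mean on the pairs (k, t) is supported on permutations t, on which the
    action is free. For fixed t, acting by f translates k by an element of G^P
    that does not depend on k and replaces t by its composite with the block
    permutation of f; the product mean absorbs the former and the sum over t
    the latter. *)
Lemma amenable_block_mean : amenable R G -> exists M : (K -> R) -> R,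
  is_mean M /\ forall f, biblockwise f -> invariant_mean M (fun h => (f * h)%g).
Proof.
move=> /amenableP[m [mm mG]].
have [Pm [Pmm PmG]] := product_mean_exists P mm mG.
have [|||||r rP] := @equivariant_selection K biblockwise
   ((P -> G) * (P -> P))%type block_act (fun=> 1%g, id).
- by split; rewrite ?invg1; exact: blockwise1.
- by move=> f [bf bfV]; split; rewrite ?invgK.
- by move=> f h [bf bfV] [bh bhV]; split; rewrite ?invgM; exact: blockwiseM.
- exact: block_act1.
- by move=> f h y [bf _] _; exact: block_actM.
pose M u :=
  (\sum_(s : {perm P}) Pm (fun k => u (k, s : P -> P))) / #|{perm P}|%:R.
have MM : is_mean M.
  apply: mean_average => [|s]; first by apply/card_gt0P; exists 1%g.
  exact: (mean_map (fun k => (k, s : P -> P)) Pmm).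
exists (fun u => M (fun y => u (r y))); split; first exact: (mean_map r MM).
move=> f bbf u bu; congr (_ / _).
rewrite [RHS](reindex_inj (mulIg (perm (block_perm_inj bbf)))) /=.
apply: eq_bigr => s _.
rewrite -[RHS](PmG (fun i => cocycle f (rho (s i)))); last first.
  exact: (bounded_fun_comp (fun k => r (k, _)) bu).
congr Pm; apply/funext => k; congr u; rewrite -rP //; last first.
  move=> h [bh _]; apply: block_act_free => // i; exists ((s^-1)%g i).
  by rewrite permKV.
congr r; congr pair; apply/funext => i.
by rewrite permM permE.
Qed.

End Blocks.

(** * Amenability of the topological full group *)

Theorem theoremA (R : realType) (G : groupType) (X : metricType R)
    (alpha : action G X)
    (G_countable : countable [set: G])
    (G_infinite : infinite_set [set: G])
    (X_cantor : cantor_set X)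
    (alpha_distal : distal alpha)
    (free_dense : dense [set x : X | free_point alpha x]) :
  amenable R (full_group alpha) <-> amenable R G.
Proof.
have [c [_ [g [gc cK gK]]]] := X_cantor.
have cX : compact [set: X].
  have -> : [set: X] = g @` [set: cantor_space].
    by apply/seteqP; split=> // x _; exists (c x).
  apply: continuous_compact cantor_space_compact.
  exact: continuous_subspaceT.
have [|x0 [_ fx0]] := free_dense setT _ openT.
  by exists (g point).
split; first exact: amenable_of_full_group fx0.
move=> aG; apply: amenable_local => F.
pose F' := F ++ [seq (f^-1)%g | f <- F].
pose kappa x := [seq cocycle f x | f <- F'].
have kc : locally_constant kappa.
  rewrite /kappa => x; elim: (F') => [|f L IH]; first exact: nearW.
  by apply: filterS2 (cocycle_locally_constant f x) IH => y /= -> ->.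
have [s sP] := compact_locally_constant_range cX kc.
pose S0 := flatten s; pose S := 1%g :: S0 ++ [seq (h^-1)%g | h <- S0].
have S1 : 1%g \in S by exact: mem_head.
have SV h : h \in S -> (h^-1)%g \in S.
  rewrite !inE !mem_cat => /or3P[/eqP->|hS|/mapP[k kS ->]].
  - by rewrite invg1 eqxx.
  - by rewrite map_f ?orbT.
  - by rewrite invgK kS orbT.
have SF f x : f \in F' -> cocycle f x \in S.
  move=> fF; rewrite inE mem_cat; apply/orP; right; apply/orP; left.
  by apply/flattenP; exists (kappa x) => //; exact: map_f.
have [N NP] := distal_stabilization cX alpha_distal kc S1 SV.
pose lambda x := [seq kappa (alpha h x) | h <- words S N].
have lP x y : lambda x = lambda y <->
    forall h, h \in words S N -> kappa (alpha h x) = kappa (alpha h y).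
  by rewrite -eq_in_map.
have lc : locally_constant lambda.
  move=> x; apply: filterS (locally_constant_translates alpha kc (words S N) x).
  by move=> y; exact: (lP y x).2.
have [P [pi [rho [rhoK piE]]]] := compact_locally_constant_quotient cX lc.
(* The elements of S move points of one block to points of one block, since
   agreement of kappa on words of length N extends to length N + 1. *)
have F'block f : f \in F' -> blockwise pi rho f.
  move=> fF x.
  have /piE/lP/NP xr : pi x = pi (rho (pi x)) by rewrite rhoK.
  have cE : cocycle f x = cocycle f (rho (pi x)).
    have := xr _ _ (words_one S1 0); rewrite !act1 => /eq_in_map; exact.
  split=> //; apply/piE/lP => h hN; rewrite !cocycleE -cE -!actM.
  exact/xr/(words_mul hN)/words1/SF.
have [M [MM MP]] := amenable_block_mean free_dense rhoK aG.
exists M; split=> // f fF; apply: MP; split; apply: F'block.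
  by rewrite mem_cat fF.
by rewrite mem_cat map_f ?orbT.
Qed.
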